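(* Let $f=h\overline{g}$ be a sense-preserving logharmonic mapping in the unit disk $\mathbb{D}$ with dilatation $\omega=\dfrac{g'h}{gh'}$, and let $\psi$ be an analytic function in $\mathbb{D}$ such that $\psi'=h'g$ in $\mathbb{D}$. Then either $\|P_f\|=\|P_\psi\|=\infty$, or both $\|P_f\|$ and $\|P_\psi\|$ are finite. If $\|P_f\|$ is finite, then $$\Big|\,\|P_f\|-\|P_\psi\|\,\Big|\le 1,$$ and the constant $1$ is sharp (i.e. it cannot be replaced by any smaller constant valid for all such $f$).
   Context: $\mathbb{D}=\{z\in\mathbb{C}:|z|<1\}$. A sense-preserving logharmonic mapping $f=h\overline{g}$ in $\mathbb{D}$ means here: $h$ and $g$ are analytic in $\mathbb{D}$, $h$ is locally univalent ($h'\neq 0$ in $\mathbb{D}$; $h$ itself is allowed to vanish), $g$ is nonvanishing in $\mathbb{D}$, and the dilatation $\omega=g'h/(gh')$ is an analytic function $\omega:\mathbb{D}\to\mathbb{D}$ (so that the Jacobian $J_f=|f_z|^2-|f_{\overline z}|^2=|h'g|^2(1-|\omega|^2)$ is positive). The pre-Schwarzian derivative of such an $f$ is $$P_f=(\log J_f)_z=\frac{h''}{h'}+\frac{g'}{g}-\frac{\overline{\omega}\,\omega'}{1-|\omega|^2}.$$ For a locally univalent analytic function $\psi$ in $\mathbb{D}$, the pre-Schwarzian derivative is $P_\psi=\psi''/\psi'$. In both cases the pre-Schwarzian norm is $\|P\|=\sup_{z\in\mathbb{D}}(1-|z|^2)|P(z)|\in[0,\infty]$. *)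

(* Defs.v *)
From Stdlib Require Import Reals.
From Coquelicot Require Import Coquelicot.
Open Scope R_scope.

Definition in_disk (z : C) : Prop := Cmod z < 1.

(* Functions on the disk are total functions C -> C of which only the values
   on the disk matter.  Analytic: at every point of the disk, the function is
   the sum of a power series on some neighbourhood of that point. *)
Definition analytic_in_disk (u : C -> C) : Prop :=
  forall z : C, in_disk z ->
  exists (a : nat -> C) (r : R), 0 < r /\
    forall w : C, Cmod (w - z) < r ->
      @is_pseries C_AbsRing C_NormedModule a (w - z)%C (u w).

Definition partial_x (F : C -> C) (z : C) : C :=
  (Derive (fun t : R => fst (F (t, snd z))) (fst z),
   Derive (fun t : R => snd (F (t, snd z))) (fst z)).

Definition partial_y (F : C -> C) (z : C) : C :=
  (Derive (fun t : R => fst (F (fst z, t))) (snd z),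
   Derive (fun t : R => snd (F (fst z, t))) (snd z)).

(* Wirtinger derivatives d/dz and d/d(conj z). *)
Definition dz (F : C -> C) (z : C) : C :=
  ((partial_x F z - Ci * partial_y F z) / 2)%C.

Definition dzbar (F : C -> C) (z : C) : C :=
  ((partial_x F z + Ci * partial_y F z) / 2)%C.

Definition jacobian (f : C -> C) (z : C) : R :=
  Cmod (dz f z) ^ 2 - Cmod (dzbar f z) ^ 2.

Definition dilatation (h g : C -> C) (z : C) : C :=
  (C_derive g z * h z / (g z * C_derive h z))%C.

(* [h] may vanish; local univalence of [h] is [h' <> 0]. *)
Definition sense_preserving_logharmonic (f h g : C -> C) : Prop :=
  (forall z : C, in_disk z -> f z = (h z * Cconj (g z))%C) /\
  analytic_in_disk h /\ analytic_in_disk g /\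
  (forall z : C, in_disk z -> C_derive h z <> 0%C) /\
  (forall z : C, in_disk z -> g z <> 0%C) /\
  analytic_in_disk (dilatation h g) /\
  (forall z : C, in_disk z -> in_disk (dilatation h g z)).

(* P_f = (log J_f)_z for a logharmonic mapping f. *)
Definition preSchwarzian (f : C -> C) (z : C) : C :=
  dz (fun w : C => RtoC (ln (jacobian f w))) z.

(* P_psi = psi'' / psi' for a locally univalent analytic function psi. *)
Definition preSchwarzian_analytic (psi : C -> C) (z : C) : C :=
  (C_derive (C_derive psi) z / C_derive psi z)%C.

(* The supremum is taken over a nonempty set of nonnegative reals, so it is
   either finite or [p_infty]. *)
Definition preSchwarzian_norm (P : C -> C) : Rbar :=
  Lub_Rbar (fun x : R =>
    exists z : C, in_disk z /\ x = (1 - Cmod z ^ 2) * Cmod (P z)).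

(* Main.v *)
Require Import Defs.
From Stdlib Require Import Reals Lra Lia Psatz.
From Stdlib Require Import Classical ClassicalEpsilon FunctionalExtensionality.
From Coquelicot Require Import Coquelicot.
Open Scope R_scope.

(** Write w for the dilatation of f.  Since J_f = |psi'|^2 (1 - |w|^2), taking
    the logarithm and applying d/dz gives

      P_f = P_psi - conj(w) w' / (1 - |w|^2)    ([preSchwarzian_logharmonic]).

    By the Schwarz-Pick inequality (1 - |z|^2) |w'| <= 1 - |w|^2, so the weighted
    quantities (1 - |z|^2) |P_f| and (1 - |z|^2) |P_psi| differ by at most
    |w| <= 1 at every point ([weighted_preSchwarzian_diff_le_1]); hence so do
    their suprema, which are therefore finite or infinite together.

    Schwarz-Pick is proved by Ahlfors' method, which needs neither Cauchy's
    formula nor disk automorphisms.  For s < 1 the quotient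
    v = |w'| (s - |z|^2) / (1 - |w|^2), extended by 0 outside |z|^2 < s, is
    continuous on the plane and attains its maximum.  At a maximum where v > 0
    the Laplacian of log v^2 is nonpositive; as log|w'|^2 is harmonic and
    log(k - |u|^2) has Laplacian -4 k |u'|^2 / (k - |u|^2)^2, this says
    v^2 <= s <= 1 there, hence everywhere.  Then s tends to 1.  The same
    computation of first and second derivatives ([jet2]) serves both the formula
    for P_f and this maximum argument.

    For sharpness, psi(z) = z has P_psi = 0, and w(z) = z is then the dilatation
    for h = 2z/(2+z), g = (1+z/2)^2: indeed h'g = 1 makes (hg)' = 1 + z, with the
    solution hg = z + z^2/2, and g'/g = w/(hg) = 2/(2+z).  Here
    (1 - |z|^2) |P_f| = |z|, whose supremum is 1. *)

(** * Complex differentiability in real terms *)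

Notation has_cderive u z l := (@is_derive C_AbsRing C_NormedModule u z l).

Lemma Cmod_fst_le (z : C) : Rabs (fst z) <= Cmod z.
Proof. eapply Rle_trans; [ apply Rmax_l | apply Rmax_Cmod ]. Qed.

Lemma Cmod_snd_le (z : C) : Rabs (snd z) <= Cmod z.
Proof. eapply Rle_trans; [ apply Rmax_r | apply Rmax_Cmod ]. Qed.

Lemma Cmod_sqr (z : C) : Cmod z ^ 2 = fst z ^ 2 + snd z ^ 2.
Proof. exact (Cmod2_alt z). Qed.

Lemma locally_Cmod (z : C) (P : C -> Prop) :
  @locally (AbsRing_UniformSpace C_AbsRing) z P <->
  exists d : posreal, forall w : C, Cmod (w - z) < d -> P w.
Proof. split; intros [d Hd]; exists d; intros w Hw; apply Hd; exact Hw. Qed.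

Lemma has_cderive_iff (u : C -> C) (z l : C) :
  has_cderive u z l <->
  forall eps : posreal, exists d : posreal, forall w : C, Cmod (w - z) < d ->
    Cmod (u w - u z - l * (w - z))%C <= eps * Cmod (w - z).
Proof.
  split.
  - intros [_ H] eps.
    specialize (H z (fun P Q => Q) eps).
    apply locally_Cmod in H. destruct H as [d Hd]; exists d; intros w Hw.
    specialize (Hd w Hw).
    replace (u w - u z - l * (w - z))%C with (u w - u z - (w - z) * l)%C by ring.
    exact Hd.
  - intros H; split.
    + apply is_linear_scal_l.
    + intros x Hx eps.
      assert (Hz := @is_filter_lim_locally_unique C_AbsRing (AbsRing_NormedModule C_AbsRing) z x Hx); rewrite <- Hz.
      destruct (H eps) as [d Hd].
      apply locally_Cmod. exists d; intros w Hw.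
      specialize (Hd w Hw).
      replace (u w - u z - l * (w - z))%C with (u w - u z - (w - z) * l)%C in Hd by ring.
      exact Hd.
Qed.

Lemma is_derive_R_iff (v : R -> R) (t l : R) :
  is_derive v t l <->
  forall eps : posreal, exists d : posreal, forall s : R, Rabs (s - t) < d ->
    Rabs (v s - v t - l * (s - t)) <= eps * Rabs (s - t).
Proof.
  split.
  - intros [_ H] eps.
    specialize (H t (fun P Q => Q) eps).
    destruct H as [d Hd]; exists d; intros s Hs.
    specialize (Hd s Hs).
    replace (v s - v t - l * (s - t)) with (v s - v t - (s - t) * l) by ring.
    exact Hd.
  - intros H; split.
    + apply is_linear_scal_l.
    + intros x Hx eps.
      assert (Hz := @is_filter_lim_locally_unique R_AbsRing R_NormedModule t x Hx); rewrite <- Hz.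
      destruct (H eps) as [d Hd].
      exists d; intros s Hs.
      specialize (Hd s Hs).
      replace (v s - v t - l * (s - t)) with (v s - v t - (s - t) * l) in Hd by ring.
      exact Hd.
Qed.

(** The Cauchy-Riemann equations. *)
Lemma has_cderive_partials (u : C -> C) (p l : C) :
  has_cderive u p l ->
  (is_derive (fun t : R => fst (u (t, snd p))) (fst p) (fst l) /\
   is_derive (fun t : R => snd (u (t, snd p))) (fst p) (snd l)) /\
  (is_derive (fun t : R => fst (u (fst p, t))) (snd p) (- snd l) /\
   is_derive (fun t : R => snd (u (fst p, t))) (snd p) (fst l)).
Proof.
  destruct p as [x y]. intros H. rewrite has_cderive_iff in H.
  assert (Ex : forall t : R, ((t, y) - (x, y))%C = RtoC (t - x)).
  { intros t. unfold RtoC, Cminus, Cplus, Copp; simpl. f_equal; ring. }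
  assert (Ey : forall t : R, ((x, t) - (x, y))%C = (Ci * RtoC (t - y))%C).
  { intros t. unfold RtoC, Ci, Cmult, Cminus, Cplus, Copp; simpl. f_equal; ring. }
  assert (Nx : forall t : R, Cmod ((t, y) - (x, y))%C = Rabs (t - x))
    by (intros t; rewrite Ex; apply Cmod_R).
  assert (Ny : forall t : R, Cmod ((x, t) - (x, y))%C = Rabs (t - y))
    by (intros t; rewrite Ey, Cmod_mult, Cmod_Ci, Cmod_R; ring).
  split; split; apply is_derive_R_iff; intros eps; destruct (H eps) as [d Hd];
    exists d; intros t Ht; simpl in Ht |- *.
  - specialize (Hd (t, y)). rewrite Nx in Hd. specialize (Hd Ht).
    eapply Rle_trans; [ | exact Hd ]. rewrite Ex.
    eapply Rle_trans; [ | apply Cmod_fst_le ]. apply Req_le, f_equal. simpl. ring.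
  - specialize (Hd (t, y)). rewrite Nx in Hd. specialize (Hd Ht).
    eapply Rle_trans; [ | exact Hd ]. rewrite Ex.
    eapply Rle_trans; [ | apply Cmod_snd_le ]. apply Req_le, f_equal. simpl. ring.
  - specialize (Hd (x, t)). rewrite Ny in Hd. specialize (Hd Ht).
    eapply Rle_trans; [ | exact Hd ]. rewrite Ey.
    eapply Rle_trans; [ | apply Cmod_fst_le ]. apply Req_le, f_equal. simpl. ring.
  - specialize (Hd (x, t)). rewrite Ny in Hd. specialize (Hd Ht).
    eapply Rle_trans; [ | exact Hd ]. rewrite Ey.
    eapply Rle_trans; [ | apply Cmod_snd_le ]. apply Req_le, f_equal. simpl. ring.
Qed.

(** * Term-by-term differentiation of complex power series *)

Lemma pow_n_Cpow (w : C) (n : nat) : @pow_n C_AbsRing w n = (w ^ n)%C.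
Proof.
  induction n as [|n IH]; [ reflexivity | ].
  rewrite Cpow_S, <- IH. reflexivity.
Qed.

Lemma is_pseries_C (a : nat -> C) (w l : C) :
  @is_pseries C_AbsRing C_NormedModule a w l <->
  @is_series C_AbsRing C_NormedModule (fun n => (a n * w ^ n)%C) l.
Proof.
  assert (E : forall n, @scal C_AbsRing C_NormedModule (@pow_n C_AbsRing w n) (a n)
                        = (a n * w ^ n)%C).
  { intros n. exact (eq_trans (Cmult_comm _ _) (f_equal (Cmult (a n)) (pow_n_Cpow w n))). }
  split; intros H.
  - exact (is_series_ext _ _ l E H).
  - exact (is_series_ext _ _ l (fun n => eq_sym (E n)) H).
Qed.

Lemma Cmod_sum_n_le (f : nat -> C) (c : nat -> R) (n : nat) :
  (forall n, Cmod (f n) <= c n) ->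
  Cmod (@sum_n C_NormedModule f n) <= sum_n c n.
Proof.
  intros H; induction n as [|n IH].
  - rewrite !sum_O. apply H.
  - rewrite !sum_Sn. eapply Rle_trans; [ apply Cmod_triangle | ].
    apply Rplus_le_compat; [ exact IH | apply H ].
Qed.

Lemma is_series_Cmod_le (f : nat -> C) (c : nat -> R) (s : C) (K : R) :
  (forall n, Cmod (f n) <= c n) ->
  @is_series C_AbsRing C_NormedModule f s -> is_series c K -> Cmod s <= K.
Proof.
  intros Hfc Hf Hc.
  assert (Hn : is_lim_seq (fun n => Cmod (@sum_n C_NormedModule f n)) (Cmod s)).
  { eapply filterlim_comp; [ exact Hf | ].
    exact (@filterlim_norm C_AbsRing C_NormedModule s). }
  exact (is_lim_seq_le _ _ (Finite (Cmod s)) (Finite K)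
           (fun n => Cmod_sum_n_le f c n Hfc) Hn Hc).
Qed.

Lemma ex_series_C_le (f : nat -> C) (c : nat -> R) :
  (forall n, Cmod (f n) <= c n) -> ex_series c ->
  exists s : C, @is_series C_AbsRing C_NormedModule f s.
Proof.
  intros H Hc. exact (@ex_series_le C_AbsRing C_CompleteNormedModule f c H Hc).
Qed.

(** Passing to the moduli of the coefficients makes the real theory of the radius
    of convergence, in particular its invariance under formal derivation,
    available for complex series. *)
Lemma CV_radius_Cmod (a : nat -> C) (r : R) :
  0 < r ->
  (exists l, @is_series C_AbsRing C_NormedModule (fun n => (a n * RtoC r ^ n)%C) l) ->
  Rbar_le r (CV_radius (fun n => Cmod (a n))).
Proof.
  intros Hr [l Hl].
  assert (Hb : exists M : R, forall n : nat, Rabs (Cmod (a n) * r ^ n) <= M).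
  { assert (Hc := @Cauchy_ex_series C_AbsRing C_CompleteNormedModule _ (ex_intro _ l Hl)).
    destruct (Hc (mkposreal 1 Rlt_0_1)) as [N HN].
    (* All terms after some index have modulus at most 1. *)
    assert (Hfin : forall m, exists M : R, forall n : nat, (n < m)%nat ->
              Rabs (Cmod (a n) * r ^ n) <= M).
    { induction m as [|m [M IH]].
      - exists 0; intros n Hn; lia.
      - exists (Rmax M (Rabs (Cmod (a m) * r ^ m))). intros n Hn.
        destruct (Nat.eq_dec n m) as [->|Hne]; [ apply Rmax_r | ].
        eapply Rle_trans; [ apply IH; lia | apply Rmax_l ]. }
    destruct (Hfin N) as [M HM]. exists (Rmax M 1). intros n.
    destruct (Compare_dec.lt_dec n N) as [Hn|Hn].
    - eapply Rle_trans; [ apply HM; exact Hn | apply Rmax_l ].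
    - eapply Rle_trans; [ | apply Rmax_r ].
      specialize (HN n n ltac:(lia) ltac:(lia)).
      rewrite sum_n_n in HN. simpl in HN. apply Rlt_le in HN.
      change (Cmod (a n * RtoC r ^ n)%C <= 1) in HN.
      rewrite Cmod_mult, Cmod_pow, Cmod_R, (Rabs_right r) in HN by lra.
      rewrite Rabs_right; [ exact HN | ].
      apply Rle_ge, Rmult_le_pos; [ apply Cmod_ge_0 | apply pow_le; lra ]. }
  exact (proj1 (CV_radius_bounded (fun n => Cmod (a n))) r Hb).
Qed.

(** The second-order remainder of v^(n+2) around w.  The bound is twice the
    optimal one: with (n+1)(n+2) it is exactly the n-th coefficient of the twice
    derived series. *)
Lemma Cpow_taylor_le (w v : C) (rho : R) (n : nat) :
  Cmod w <= rho -> Cmod v <= rho ->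
  Cmod (v ^ (S (S n)) - w ^ (S (S n)) - INR (S (S n)) * w ^ (S n) * (v - w))%C <=
  INR (S n) * INR (S (S n)) * rho ^ n * Cmod (v - w) ^ 2.
Proof.
  intros Hw Hv.
  assert (Hr : 0 <= rho) by (eapply Rle_trans; [ apply Cmod_ge_0 | exact Hw ]).
  induction n as [|n IH].
  - replace (v ^ 2 - w ^ 2 - INR 2 * w ^ 1 * (v - w))%C with ((v - w) * (v - w))%C.
    + rewrite Cmod_mult. simpl. assert (H := Cmod_ge_0 (v - w)). nra.
    + replace (RtoC (INR 2)) with (RtoC 2) by reflexivity. rewrite !Cpow_S. simpl.
      ring.
  - replace (v ^ S (S (S n)) - w ^ S (S (S n)) - INR (S (S (S n))) * w ^ S (S n) * (v - w))%C
      with (v * (v ^ (S (S n)) - w ^ (S (S n)) - INR (S (S n)) * w ^ (S n) * (v - w))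
            + INR (S (S n)) * w ^ S n * ((v - w) * (v - w)))%C.
    2:{ rewrite (S_INR (S (S n))), RtoC_plus, !Cpow_S. ring. }
    eapply Rle_trans; [ apply Cmod_triangle | ].
    rewrite !Cmod_mult, Cmod_pow, Cmod_R, (Rabs_right (INR (S (S n))))
      by apply Rle_ge, pos_INR.
    assert (H1 : Cmod w ^ S n <= rho ^ S n) by (apply pow_incr; split; [ apply Cmod_ge_0 | exact Hw ]).
    set (D := Cmod (v ^ S (S n) - w ^ S (S n) - INR (S (S n)) * w ^ S n * (v - w))%C) in *.
    assert (HD : 0 <= D) by apply Cmod_ge_0.
    assert (Hk := Cmod_ge_0 (v - w)). set (k := Cmod (v - w)%C) in *.
    set (m := INR (S (S n))) in *.
    assert (Hm : INR (S n) = m - 1) by (unfold m; rewrite (S_INR (S n)); ring).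
    assert (Hm3 : INR (S (S (S n))) = m + 1) by (unfold m; rewrite (S_INR (S (S n))); ring).
    assert (Hm0 : 0 <= m) by apply pos_INR.
    rewrite Hm in IH. rewrite Hm3.
    assert (Hp : 0 <= rho ^ n) by (apply pow_le; exact Hr).
    apply Rle_trans with (rho * ((m - 1) * m * rho ^ n * k ^ 2) + m * rho ^ S n * (k * k)).
    + apply Rplus_le_compat.
      * apply Rmult_le_compat; [ apply Cmod_ge_0 | exact HD | exact Hv | exact IH ].
      * apply Rmult_le_compat_r; [ nra | ].
        apply Rmult_le_compat_l; [ exact Hm0 | exact H1 ].
    + simpl. assert (0 <= m * (rho * rho ^ n) * (k * k)).
      { repeat apply Rmult_le_pos; lra. }
      nra.
Qed.

Notation is_cseries f s := (@is_series C_AbsRing C_NormedModule f s).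

Lemma is_cseries_ext (f g : nat -> C) (s : C) :
  (forall n, f n = g n) -> is_cseries f s -> is_cseries g s.
Proof. exact (@is_series_ext C_AbsRing C_NormedModule f g s). Qed.

Lemma is_cseries_shift (f : nat -> C) (s : C) :
  is_cseries f s -> is_cseries (fun n => f (S n)) (s - f O)%C.
Proof.
  intros H. apply (@is_series_incr_1 C_AbsRing C_NormedModule f).
  change (is_cseries f (s - f O + f O)%C).
  replace (s - f O + f O)%C with s by ring. exact H.
Qed.

(** Inside a smaller disk of radius rho, the difference between u and its candidate
    linear approximation at w is bounded by |v - w|^2 times the twice derived
    series of moduli at rho, which converges. *)
Lemma pseries_termwise_derive (a : nat -> C) (u : C -> C) (r : R) (w : C) :
  Cmod w < r ->
  (forall v : C, Cmod v < r -> is_cseries (fun n => (a n * v ^ n)%C) (u v)) ->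
  exists l : C,
    is_cseries (fun n => (INR (S n) * a (S n) * w ^ n)%C) l /\
    has_cderive u w l.
Proof.
  intros Hw Hu.
  assert (Hw0 := Cmod_ge_0 w).
  set (rho := (Cmod w + r) / 2). set (r1 := (rho + r) / 2).
  assert (Hrho : 0 < rho) by (unfold rho; lra).
  assert (Hr : Cmod w < rho /\ rho < r1 /\ r1 < r) by (unfold r1, rho; lra).
  set (b := fun n => Cmod (a n)).
  assert (Hcv : Rbar_lt (Rabs rho) (CV_radius b)).
  { eapply Rbar_lt_le_trans; [ | apply (CV_radius_Cmod a r1) ].
    - simpl. rewrite Rabs_right; lra.
    - lra.
    - exists (u (RtoC r1)). apply Hu. rewrite Cmod_R, Rabs_right; lra. }
  assert (Hc1 : ex_series (fun n => Rabs (PS_derive b n * rho ^ n)))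
    by (apply CV_disk_inside; rewrite CV_radius_derive; exact Hcv).
  assert (Hc2 : ex_series (fun n => Rabs (PS_derive (PS_derive b) n * rho ^ n)))
    by (apply CV_disk_inside; rewrite !CV_radius_derive; exact Hcv).
  destruct (ex_series_C_le (fun n => (INR (S n) * a (S n) * w ^ n)%C)
              (fun n => Rabs (PS_derive b n * rho ^ n))) with (2 := Hc1) as [l Hl].
  { intros n. unfold PS_derive. rewrite !Cmod_mult, Cmod_pow, Cmod_R, !Rabs_mult.
    fold (b (S n)). rewrite (Rabs_right (b (S n))) by apply Rle_ge, Cmod_ge_0.
    apply Rmult_le_compat_l.
    - apply Rmult_le_pos; [ apply Rabs_pos | apply Cmod_ge_0 ].
    - rewrite Rabs_right by (apply Rle_ge, pow_le; lra).
      apply pow_incr; lra. }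
  exists l; split; [ exact Hl | ].
  destruct Hc2 as [K HK].
  assert (Hq : forall v, Cmod v <= rho ->
            Cmod (u v - u w - l * (v - w))%C <= Rabs K * Cmod (v - w) ^ 2).
  { intros v Hv.
    (* The first two terms of the remainder series vanish, hence the two shifts. *)
    assert (Hs : is_cseries (fun n => (a (S (S n)) *
        (v ^ (S (S n)) - w ^ (S (S n)) - INR (S (S n)) * w ^ (S n) * (v - w)))%C)
        (u v - u w - l * (v - w))%C).
    { assert (Hv' := is_cseries_shift _ _ (Hu v ltac:(lra))).
      assert (Hw' := is_cseries_shift _ _ (Hu w ltac:(lra))).
      assert (Hl' := @is_series_scal C_AbsRing C_NormedModule (v - w)%C _ _ Hl).
      assert (Hd := @is_series_minus C_AbsRing C_NormedModule _ _ _ _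
        (@is_series_minus C_AbsRing C_NormedModule _ _ _ _ Hv' Hw') Hl').
      assert (Hd' := is_cseries_shift _ _ Hd).
      match type of Hd' with is_cseries ?f ?x =>
        replace (u v - u w - l * (v - w))%C with x end.
      - refine (is_cseries_ext _ _ _ _ Hd'). intros n.
        change ((a (S (S n)) * v ^ S (S n) - a (S (S n)) * w ^ S (S n)
          - (v - w) * (INR (S (S n)) * a (S (S n)) * w ^ S n) =
          a (S (S n)) * (v ^ S (S n) - w ^ S (S n) - INR (S (S n)) * w ^ S n * (v - w)))%C).
        ring.
      - change ((u v - a O * v ^ O - (u w - a O * w ^ O) - (v - w) * l
           - (a 1%nat * v ^ 1 - a 1%nat * w ^ 1 - (v - w) * (INR 1 * a 1%nat * w ^ O))
           = u v - u w - l * (v - w))%C).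
        rewrite !Cpow_S. change (INR 1) with 1. simpl. ring. }
    apply Rle_trans with (K * Cmod (v - w) ^ 2);
      [ | apply Rmult_le_compat_r; [ apply pow2_ge_0 | apply Rle_abs ] ].
    refine (is_series_Cmod_le _ _ _ _ _ Hs
      (is_series_scal_r (Cmod (v - w) ^ 2) _ _ HK)).
    intros n. cbv beta. rewrite Cmod_mult. eapply Rle_trans.
    + apply Rmult_le_compat_l; [ apply Cmod_ge_0 | ].
      apply (Cpow_taylor_le w v rho n); lra.
    + unfold PS_derive. fold (b (S (S n))).
      assert (0 <= b (S (S n))) by apply Cmod_ge_0.
      rewrite Rabs_right.
      * apply Req_le; ring.
      * apply Rle_ge. repeat apply Rmult_le_pos; auto using pos_INR.
        apply pow_le; lra. }
  assert (HK0 := Rabs_pos K).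
  apply has_cderive_iff. intros eps.
  assert (He := cond_pos eps).
  assert (Hd : 0 < Rmin (rho - Cmod w) (eps / (Rabs K + 1))).
  { apply Rmin_pos; [ lra | apply Rdiv_lt_0_compat; lra ]. }
  exists (mkposreal _ Hd). intros v Hv. simpl in Hv.
  assert (Hv1 := Rlt_le_trans _ _ _ Hv (Rmin_l _ _)).
  assert (Hv2 := Rlt_le_trans _ _ _ Hv (Rmin_r _ _)).
  eapply Rle_trans; [ apply Hq | ].
  - replace v with (w + (v - w))%C by ring.
    eapply Rle_trans; [ apply Cmod_triangle | lra ].
  - assert (H0 := Cmod_ge_0 (v - w)). set (k := Cmod (v - w)%C) in *.
    apply Rlt_le in Hv2. apply (Rmult_le_compat_r (Rabs K + 1)) in Hv2; [ | lra ].
    unfold Rdiv in Hv2. rewrite Rmult_assoc, Rinv_l, Rmult_1_r in Hv2 by lra.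
    simpl. nra.
Qed.

(** * Analytic functions in the disk *)

Lemma has_cderive_shift (u : C -> C) (z w l : C) :
  has_cderive (fun v => u (z + v)%C) w l -> has_cderive u (z + w)%C l.
Proof.
  rewrite !has_cderive_iff. intros H eps. destruct (H eps) as [d Hd].
  exists d; intros v Hv. specialize (Hd (v - z)%C). cbv beta in Hd.
  replace (z + (v - z))%C with v in Hd by ring.
  replace (v - z - w)%C with (v - (z + w))%C in Hd by ring.
  exact (Hd Hv).
Qed.

Lemma pseries_C_derive (a : nat -> C) (u : C -> C) (r : R) (z w : C) :
  (forall w : C, Cmod (w - z) < r ->
     @is_pseries C_AbsRing C_NormedModule a (w - z)%C (u w)) ->
  Cmod (w - z) < r ->
  has_cderive u w (C_derive u w) /\
  @is_pseries C_AbsRing C_NormedModule (fun n => (INR (S n) * a (S n))%C)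
    (w - z)%C (C_derive u w).
Proof.
  intros Hu Hw.
  destruct (pseries_termwise_derive a (fun v => u (z + v)%C) r (w - z)%C Hw) as [l [Hl Hd]].
  { intros v Hv. apply is_pseries_C. replace v with (z + v - z)%C at 1 by ring.
    apply Hu. replace (z + v - z)%C with v by ring. exact Hv. }
  apply has_cderive_shift in Hd.
  replace (z + (w - z))%C with w in Hd by ring.
  rewrite (is_C_derive_unique _ _ _ Hd). split; [ exact Hd | ].
  apply is_pseries_C. exact Hl.
Qed.

Lemma analytic_has_cderive (u : C -> C) (z : C) :
  analytic_in_disk u -> in_disk z -> has_cderive u z (C_derive u z).
Proof.
  intros Hu Hz. destruct (Hu z Hz) as (a & r & Hr & H).
  apply (pseries_C_derive a u r z z H).
  replace (z - z)%C with (RtoC 0) by ring. rewrite Cmod_0. exact Hr.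
Qed.

Lemma analytic_C_derive (u : C -> C) :
  analytic_in_disk u -> analytic_in_disk (C_derive u).
Proof.
  intros Hu z Hz. destruct (Hu z Hz) as (a & r & Hr & H).
  exists (fun n => (INR (S n) * a (S n))%C), r. split; [ exact Hr | ].
  intros w Hw. exact (proj2 (pseries_C_derive a u r z w H Hw)).
Qed.

Lemma analytic_continuous (u : C -> C) (z : C) :
  analytic_in_disk u -> in_disk z -> @continuous C_UniformSpace C_UniformSpace u z.
Proof.
  intros Hu Hz P HP. apply locally_C.
  apply (@ex_derive_continuous C_AbsRing C_NormedModule u z
           (ex_intro _ _ (analytic_has_cderive u z Hu Hz)) P HP).
Qed.

Lemma Cmod_continuous (z : C) : @continuous C_UniformSpace R_UniformSpace Cmod z.
Proof. exact (@filterlim_norm C_AbsRing C_NormedModule z). Qed.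

Lemma analytic_Cmod_continuous (u : C -> C) (z : C) :
  analytic_in_disk u -> in_disk z ->
  @continuous C_UniformSpace R_UniformSpace (fun w => Cmod (u w)) z.
Proof.
  intros Hu Hz. apply (continuous_comp u Cmod).
  - exact (analytic_continuous u z Hu Hz).
  - apply Cmod_continuous.
Qed.

(** Composing with atan makes F bounded, so that the supremum M exists.  If M were
    not attained, every point would have a neighbourhood where the function stays
    below M by a fixed margin delta; the compactness theorem bounds delta from
    below on the square, contradicting the choice of M. *)
Lemma continuous_attains_max_square (F : C -> R) :
  (forall z, @continuous C_UniformSpace R_UniformSpace F z) ->
  exists p : C, forall z : C, -1 <= fst z <= 1 -> -1 <= snd z <= 1 -> F z <= F p.
Proof.
  intros HF.
  set (G := fun x y => atan (F (x, y))).
  assert (HG : forall x y (h : posreal), exists d : posreal, forall x' y',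
            Rabs (x' - x) < d -> Rabs (y' - y) < d -> Rabs (G x' y' - G x y) < h).
  { intros x y h.
    assert (Hc : @continuous C_UniformSpace R_UniformSpace (fun z => atan (F z)) (x, y)).
    { apply (continuous_comp F atan); [ apply HF | ].
      apply continuity_pt_filterlim, derivable_continuous_pt, derivable_pt_atan. }
    destruct (Hc (fun v => Rabs (v - G x y) < h)) as [d Hd].
    - exists h. intros v Hv. exact Hv.
    - exists d. intros x' y' Hx Hy. apply (Hd (x', y')). split; assumption. }
  set (E := fun m => exists x y, -1 <= x <= 1 /\ -1 <= y <= 1 /\ m = G x y).
  destruct (completeness E) as [M [HM1 HM2]].
  { exists (PI / 2). intros m (x & y & _ & _ & ->). apply Rlt_le, atan_bound. }
  { exists (G 0 0), 0, 0. repeat split; lra. }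
  apply NNPP. intros Hno.
  assert (Hlt : forall x y, -1 <= x <= 1 -> -1 <= y <= 1 -> G x y < M).
  { intros x y Hx Hy. apply Rnot_le_lt. intros Hge. apply Hno.
    exists (x, y). intros [x' y'] Hx' Hy'. simpl in Hx', Hy'.
    apply Rnot_lt_le. intros Hl. apply atan_increasing in Hl.
    assert (G x' y' <= M) by (apply HM1; exists x', y'; auto).
    unfold G in *. lra. }
  assert (Hdelta : forall x y, exists d : posreal, -1 <= x <= 1 -> -1 <= y <= 1 ->
            forall x' y', Rabs (x' - x) < d -> Rabs (y' - y) < d -> G x' y' <= M - d).
  { intros x y. destruct (classic (-1 <= x <= 1 /\ -1 <= y <= 1)) as [[Hx Hy]|Hn].
    - specialize (Hlt x y Hx Hy).
      assert (Hh : 0 < (M - G x y) / 2) by lra.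
      destruct (HG x y (mkposreal _ Hh)) as [d0 Hd0]. simpl in Hd0.
      assert (Hd : 0 < Rmin d0 ((M - G x y) / 2)) by (apply Rmin_pos; [ apply cond_pos | exact Hh ]).
      exists (mkposreal _ Hd). simpl. intros _ _ x' y' Hx' Hy'.
      assert (H1 := Rmin_l d0 ((M - G x y) / 2)). assert (H2 := Rmin_r d0 ((M - G x y) / 2)).
      specialize (Hd0 x' y' ltac:(lra) ltac:(lra)). apply Rabs_def2 in Hd0. lra.
    - exists (mkposreal 1 Rlt_0_1). intros Hx Hy. tauto. }
  set (delta := fun x y => proj1_sig (constructive_indefinite_description _ (Hdelta x y))).
  destruct (compactness_value_2d (-1) 1 (-1) 1 delta) as [d Hd].
  assert (Hub : is_upper_bound E (M - d)).
  { intros m (x & y & Hx & Hy & ->).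
    destruct (NNPP _ (Hd x y Hx Hy)) as (u & v & Hu & Hv & Hxu & Hyv & Hduv).
    unfold delta in Hxu, Hyv, Hduv.
    destruct (constructive_indefinite_description _ (Hdelta u v)) as [d' Hd'].
    simpl in *. specialize (Hd' Hu Hv x y Hxu Hyv). lra. }
  apply HM2 in Hub. assert (H := cond_pos d). lra.
Qed.

(** * The second derivative test *)

Definition is_derive2 (q : R -> R) (t a b : R) : Prop :=
  exists q' : R -> R,
    locally t (fun s => is_derive q s (q' s)) /\ q' t = a /\ is_derive q' t b.

Lemma is_derive2_derive q t a b : is_derive2 q t a b -> is_derive q t a.
Proof. intros (q' & H & <- & _). exact (locally_singleton _ _ H). Qed.

Lemma is_derive2_plus p q t a b c d :
  is_derive2 p t a b -> is_derive2 q t c d ->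
  is_derive2 (fun s => p s + q s) t (a + c) (b + d).
Proof.
  intros (p' & Hp & <- & Hp') (q' & Hq & <- & Hq').
  exists (fun s => p' s + q' s). split; [ | split; [ reflexivity | ] ].
  - generalize (filter_and _ _ Hp Hq). apply filter_imp. intros s [H1 H2].
    exact (is_derive_plus _ _ _ _ _ H1 H2).
  - exact (is_derive_plus _ _ _ _ _ Hp' Hq').
Qed.

Lemma is_derive2_const k t : is_derive2 (fun _ => k) t 0 0.
Proof.
  exists (fun _ => 0). split; [ | split; [ reflexivity | ] ].
  - apply filter_forall. intros s. exact (is_derive_const k s).
  - exact (is_derive_const 0 t).
Qed.

Lemma is_derive2_mult p q t a b c d :
  is_derive2 p t a b -> is_derive2 q t c d ->
  is_derive2 (fun s => p s * q s) t (a * q t + p t * c)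
    (b * q t + 2 * a * c + p t * d).
Proof.
  intros (p' & Hp & <- & Hp') (q' & Hq & <- & Hq').
  assert (Hp0 := locally_singleton _ _ Hp). assert (Hq0 := locally_singleton _ _ Hq).
  simpl in Hp0, Hq0.
  exists (fun s => p' s * q s + p s * q' s). split; [ | split; [ reflexivity | ] ].
  - generalize (filter_and _ _ Hp Hq). apply filter_imp. intros s [H1 H2].
    refine (is_derive_mult _ _ _ _ _ H1 H2 _). intros; apply Rmult_comm.
  - replace (b * q t + 2 * p' t * q' t + p t * d)
      with ((b * q t + p' t * q' t) + (p' t * q' t + p t * d)) by ring.
    apply (is_derive_plus (V := R_NormedModule));
    refine (is_derive_mult _ _ _ _ _ _ _ _); auto; intros; apply Rmult_comm.
Qed.

Lemma is_derive2_ln q t a b :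
  0 < q t -> is_derive2 q t a b ->
  is_derive2 (fun s => ln (q s)) t (a / q t) (b / q t - (a / q t) ^ 2).
Proof.
  intros Hpos (q' & Hq & <- & Hq').
  assert (Hq0 := locally_singleton _ _ Hq). simpl in Hq0.
  assert (Hpos' : locally t (fun s => 0 < q s)).
  { apply (ex_derive_continuous q t (ex_intro _ _ Hq0)).
    exact (open_gt 0 (q t) Hpos). }
  exists (fun s => q' s / q s). split; [ | split; [ reflexivity | ] ].
  - generalize (filter_and _ _ Hq Hpos'). apply filter_imp. intros s [H1 H2].
    exact (is_derive_comp ln q s _ _ (is_derive_ln _ H2) H1).
  - replace (b / q t - (q' t / q t) ^ 2) with ((b * q t - q' t * q' t) / q t ^ 2)
      by (field; lra).
    apply is_derive_div; [ exact Hq' | exact Hq0 | lra ].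
Qed.

(** If b > 0 then q' is strictly increasing through t to first order, so q' has a
    strict sign on the right of t (if a >= 0) or on the left (if a <= 0), and the
    mean value theorem produces a nearby value exceeding q t. *)
Lemma is_derive2_max q t a b :
  is_derive2 q t a b -> locally t (fun s => q s <= q t) -> b <= 0.
Proof.
  intros (q' & Hq & Ha & Hq') Hmax.
  apply Rnot_lt_le. intros Hb.
  rewrite is_derive_R_iff in Hq'.
  assert (Hb2 : 0 < b / 2) by lra.
  destruct (Hq' (mkposreal _ Hb2)) as [d1 Hd1]. simpl in Hd1.
  destruct (filter_and _ _ Hq Hmax) as [d2 Hd2].
  assert (Hd2' : forall s, Rabs (s - t) < d2 -> is_derive q s (q' s) /\ q s <= q t)
    by (intros s Hs; exact (Hd2 s Hs)).
  set (e := Rmin d1 d2 / 2).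
  assert (He : 0 < e /\ e < d1 /\ e < d2).
  { assert (H1 := Rmin_l d1 d2). assert (H2 := Rmin_r d1 d2).
    assert (0 < Rmin d1 d2) by (apply Rmin_pos; apply cond_pos). unfold e. lra. }
  assert (Hnear : forall c, Rabs (c - t) <= e ->
             Rabs (q' c - a - b * (c - t)) <= b / 2 * Rabs (c - t))
    by (intros c Hc; rewrite <- Ha; apply Hd1; lra).
  destruct (Rle_dec 0 a) as [Ha0|Ha0].
  - destruct (MVT_cor2 q q' t (t + e)) as (c & Hc & Htc); [ lra | | ].
    + intros c Hc. apply is_derive_Reals, Hd2'. rewrite Rabs_right; lra.
    + assert (H1 := Hnear c). rewrite (Rabs_right (c - t)) in H1 by lra.
      specialize (H1 ltac:(lra)). apply Rcomplements.Rabs_le_between in H1.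
      assert (H2 : q (t + e) <= q t) by (apply Hd2'; rewrite Rabs_right; lra).
      assert (0 < q' c) by nra. nra.
  - destruct (MVT_cor2 q q' (t - e) t) as (c & Hc & Htc); [ lra | | ].
    + intros c Hc. apply is_derive_Reals, Hd2'. rewrite Rabs_left1; lra.
    + assert (H1 := Hnear c). rewrite (Rabs_left (c - t)) in H1 by lra.
      specialize (H1 ltac:(lra)). apply Rcomplements.Rabs_le_between in H1.
      assert (H2 : q (t - e) <= q t) by (apply Hd2'; rewrite Rabs_left1; lra).
      assert (q' c < 0) by nra. nra.
Qed.

(** * Wirtinger derivative and Laplacian *)

Notation clocally p P := (@locally C_UniformSpace p P).

Lemma locally_horizontal (p : C) (P : C -> Prop) :
  clocally p P -> locally (fst p) (fun t : R => P (t, snd p)).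
Proof.
  destruct p as [x y]. intros [d Hd]. exists d. intros t Ht.
  apply Hd. split; [ exact Ht | apply ball_center ].
Qed.

Lemma locally_vertical (p : C) (P : C -> Prop) :
  clocally p P -> locally (snd p) (fun t : R => P (fst p, t)).
Proof.
  destruct p as [x y]. intros [d Hd]. exists d. intros t Ht.
  apply Hd. split; [ apply ball_center | exact Ht ].
Qed.

Lemma locally_in_disk (p : C) : in_disk p -> clocally p in_disk.
Proof.
  intros Hp. apply (Cmod_continuous p (fun x => x < 1)). exact (open_lt 1 (Cmod p) Hp).
Qed.

(** d is the Wirtinger derivative of the real function Q at p and L its Laplacian:
    for real Q the partial derivatives are 2 Re d and -2 Im d. *)
Definition jet2 (Q : C -> R) (p d : C) (L : R) : Prop :=
  exists dxx dyy : R,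
    is_derive2 (fun t => Q (t, snd p)) (fst p) (2 * fst d) dxx /\
    is_derive2 (fun t => Q (fst p, t)) (snd p) (- 2 * snd d) dyy /\
    dxx + dyy = L.

Lemma is_derive2_eq q t a b a' b' :
  is_derive2 q t a b -> a = a' -> b = b' -> is_derive2 q t a' b'.
Proof. intros H <- <-. exact H. Qed.

Lemma is_derive2_ext p q t a b :
  (forall s, p s = q s) -> is_derive2 p t a b -> is_derive2 q t a b.
Proof.
  intros E (p' & H & Ha & Hb). exists p'. split; [ | split; assumption ].
  revert H. apply filter_imp. intros s. apply is_derive_ext, E.
Qed.

Lemma jet2_eq Q p d L d' L' : jet2 Q p d L -> d = d' -> L = L' -> jet2 Q p d' L'.
Proof. intros H <- <-. exact H. Qed.

Lemma jet2_ext Q Q' p d L : (forall z, Q z = Q' z) -> jet2 Q p d L -> jet2 Q' p d L.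
Proof.
  intros E (dxx & dyy & H1 & H2 & H). exists dxx, dyy.
  split; [ | split; [ | exact H ] ]; (eapply is_derive2_ext; [ | eassumption ]);
    intros t; apply E.
Qed.

Lemma jet2_plus Q Q' p d d' L L' :
  jet2 Q p d L -> jet2 Q' p d' L' ->
  jet2 (fun z => Q z + Q' z) p (d + d')%C (L + L').
Proof.
  intros (b1 & b2 & H1 & H2 & <-) (c1 & c2 & K1 & K2 & <-).
  exists (b1 + c1), (b2 + c2). split; [ | split; [ | ring ] ].
  - eapply is_derive2_eq; [ exact (is_derive2_plus _ _ _ _ _ _ _ H1 K1) | simpl; ring | reflexivity ].
  - eapply is_derive2_eq; [ exact (is_derive2_plus _ _ _ _ _ _ _ H2 K2) | simpl; ring | reflexivity ].
Qed.

Lemma jet2_scal k Q p d L :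
  jet2 Q p d L -> jet2 (fun z => k * Q z) p (k * d)%C (k * L).
Proof.
  intros (b1 & b2 & H1 & H2 & <-).
  exists (k * b1), (k * b2). split; [ | split; [ | ring ] ].
  - eapply is_derive2_eq; [ exact (is_derive2_mult _ _ _ _ _ _ _ (is_derive2_const k _) H1) | simpl; ring | simpl; ring ].
  - eapply is_derive2_eq; [ exact (is_derive2_mult _ _ _ _ _ _ _ (is_derive2_const k _) H2) | simpl; ring | simpl; ring ].
Qed.

Lemma jet2_const k p : jet2 (fun _ => k) p 0%C 0.
Proof.
  exists 0, 0. split; [ | split; [ | ring ] ];
    (eapply is_derive2_eq; [ apply is_derive2_const | simpl; ring | ring ]).
Qed.

Lemma jet2_ln Q p d L :
  0 < Q p -> jet2 Q p d L ->
  jet2 (fun z => ln (Q z)) p (d / Q p)%C (L / Q p - 4 * (Cmod d / Q p) ^ 2).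
Proof.
  destruct p as [x y]. intros Hpos (b1 & b2 & H1 & H2 & <-).
  exists (b1 / Q (x, y) - (2 * fst d / Q (x, y)) ^ 2), (b2 / Q (x, y) - (- 2 * snd d / Q (x, y)) ^ 2).
  split; [ | split ].
  - eapply is_derive2_eq; [ exact (is_derive2_ln _ _ _ _ Hpos H1) | | reflexivity ].
    simpl. field. simpl in Hpos. lra.
  - eapply is_derive2_eq; [ exact (is_derive2_ln _ _ _ _ Hpos H2) | | reflexivity ].
    simpl. field. simpl in Hpos. lra.
  - replace ((Cmod d / Q (x, y)) ^ 2) with (Cmod d ^ 2 / Q (x, y) ^ 2) by (field; lra).
    rewrite Cmod_sqr. field. lra.
Qed.

Lemma jet2_Cmod_sqr u p :
  analytic_in_disk u -> in_disk p ->
  jet2 (fun z => Cmod (u z) ^ 2) p (Cconj (u p) * C_derive u p)%C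
    (4 * Cmod (C_derive u p) ^ 2).
Proof.
  intros Hu Hp.
  assert (Hu' := analytic_C_derive u Hu).
  assert (D1 := fun z Hz => has_cderive_partials u z _ (analytic_has_cderive u z Hu Hz)).
  assert (D2 := has_cderive_partials _ p _ (analytic_has_cderive _ p Hu' Hp)).
  set (u1 := C_derive u) in *. set (u2 := C_derive u1) in *.
  assert (Hloc := locally_in_disk p Hp).
  assert (X1 : is_derive2 (fun t => fst (u (t, snd p))) (fst p) (fst (u1 p)) (fst (u2 p))).
  { exists (fun t => fst (u1 (t, snd p))). split; [ | split ].
    - generalize (locally_horizontal _ _ Hloc). apply filter_imp. intros t Ht. apply (D1 _ Ht).
    - destruct p; reflexivity.
    - apply D2. }
  assert (X2 : is_derive2 (fun t => snd (u (t, snd p))) (fst p) (snd (u1 p)) (snd (u2 p))).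
  { exists (fun t => snd (u1 (t, snd p))). split; [ | split ].
    - generalize (locally_horizontal _ _ Hloc). apply filter_imp. intros t Ht. apply (D1 _ Ht).
    - destruct p; reflexivity.
    - apply D2. }
  assert (Y1 : is_derive2 (fun t => fst (u (fst p, t))) (snd p) (- snd (u1 p)) (- fst (u2 p))).
  { exists (fun t => - snd (u1 (fst p, t))). split; [ | split ].
    - generalize (locally_vertical _ _ Hloc). apply filter_imp. intros t Ht. apply (D1 _ Ht).
    - destruct p; reflexivity.
    - apply (is_derive_opp (V := R_NormedModule)), D2. }
  assert (Y2 : is_derive2 (fun t => snd (u (fst p, t))) (snd p) (fst (u1 p)) (- snd (u2 p))).
  { exists (fun t => fst (u1 (fst p, t))). split; [ | split ].
    - generalize (locally_vertical _ _ Hloc). apply filter_imp. intros t Ht. apply (D1 _ Ht).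
    - destruct p; reflexivity.
    - apply D2. }
  assert (E : forall z, fst (u z) * fst (u z) + snd (u z) * snd (u z) = Cmod (u z) ^ 2)
    by (intros z; rewrite Cmod_sqr; ring).
  assert (X := is_derive2_plus _ _ _ _ _ _ _ (is_derive2_mult _ _ _ _ _ _ _ X1 X1) (is_derive2_mult _ _ _ _ _ _ _ X2 X2)).
  assert (Y := is_derive2_plus _ _ _ _ _ _ _ (is_derive2_mult _ _ _ _ _ _ _ Y1 Y1) (is_derive2_mult _ _ _ _ _ _ _ Y2 Y2)).
  do 2 eexists. split; [ | split ].
  - eapply is_derive2_eq; [ eapply is_derive2_ext; [ | exact X ] | | reflexivity ].
    + intros t. apply E.
    + destruct p. simpl. ring.
  - eapply is_derive2_eq; [ eapply is_derive2_ext; [ | exact Y ] | | reflexivity ].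
    + intros t. apply E.
    + destruct p. simpl. ring.
  - rewrite Cmod_sqr. destruct p. simpl. ring.
Qed.

Lemma jet2_max Q p d L :
  jet2 Q p d L -> clocally p (fun z => Q z <= Q p) -> L <= 0.
Proof.
  destruct p as [x y]. intros (b1 & b2 & H1 & H2 & <-) Hmax.
  assert (b1 <= 0) by (eapply is_derive2_max; [ exact H1 | exact (locally_horizontal _ _ Hmax) ]).
  assert (b2 <= 0) by (eapply is_derive2_max; [ exact H2 | exact (locally_vertical _ _ Hmax) ]).
  lra.
Qed.

Lemma jet2_dz Q p d L : jet2 Q p d L -> dz (fun w => RtoC (Q w)) p = d.
Proof.
  intros (b1 & b2 & H1 & H2 & _).
  apply is_derive2_derive, is_derive_unique in H1.
  apply is_derive2_derive, is_derive_unique in H2.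
  unfold dz, partial_x, partial_y. simpl.
  rewrite H1, H2, !Derive_const.
  destruct d as [a b]. unfold Cdiv, Cminus, Cplus, Cmult, Copp, Cinv, Ci, RtoC. simpl.
  f_equal; field.
Qed.

(** Away from the zeros of u, log|u|^2 is harmonic with d/dz log|u|^2 = u'/u. *)
Lemma jet2_ln_Cmod_sqr u p :
  analytic_in_disk u -> in_disk p -> u p <> 0%C ->
  jet2 (fun z => ln (Cmod (u z) ^ 2)) p (C_derive u p / u p)%C 0.
Proof.
  intros Hu Hp H0.
  assert (Hm : 0 < Cmod (u p)) by (apply Cmod_gt_0; exact H0).
  assert (J := jet2_ln _ _ _ _ (pow_lt _ 2 Hm) (jet2_Cmod_sqr u p Hu Hp)).
  apply (jet2_eq _ _ _ _ _ _ J).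
  - rewrite Cmod2_conj. field.
    split; [ exact H0 | ]. intros K. apply (f_equal Cmod) in K.
    rewrite Cmod_conj, Cmod_0 in K. lra.
  - rewrite Cmod_mult, Cmod_conj. field. lra.
Qed.

(** For k = 1 this is the curvature computation for the hyperbolic metric pulled
    back by u; general k gives, with u the identity, the metric of the disk of
    radius sqrt k. *)
Lemma jet2_ln_sub_Cmod_sqr k u p :
  analytic_in_disk u -> in_disk p -> Cmod (u p) ^ 2 < k ->
  jet2 (fun z => ln (k - Cmod (u z) ^ 2)) p
    (- (Cconj (u p) * C_derive u p / RtoC (k - Cmod (u p) ^ 2)))%C
    (- (4 * k * Cmod (C_derive u p) ^ 2 / (k - Cmod (u p) ^ 2) ^ 2)).
Proof.
  intros Hu Hp Hk.
  assert (J : jet2 (fun z => k + (-1) * Cmod (u z) ^ 2) p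
                (- (Cconj (u p) * C_derive u p))%C (- (4 * Cmod (C_derive u p) ^ 2))).
  { apply (jet2_eq _ _ _ _ _ _
      (jet2_plus _ _ _ _ _ _ _ (jet2_const k p) (jet2_scal (-1) _ _ _ _ (jet2_Cmod_sqr u p Hu Hp)))).
    - ring.
    - ring. }
  apply jet2_ext with (Q' := fun z => k - Cmod (u z) ^ 2) in J; [ | intros z; ring ].
  apply jet2_ln in J; [ | lra ].
  apply (jet2_eq _ _ _ _ _ _ J).
  - unfold Cdiv. ring.
  - rewrite Cmod_opp, Cmod_mult, Cmod_conj. field. lra.
Qed.

(** * Series sums and quadratic polynomials *)

Lemma is_cseries_unique (f : nat -> C) (s t : C) :
  is_cseries f s -> is_cseries f t -> s = t.
Proof.
  intros Hs Ht.
  exact (@filterlim_locally_unique nat C_AbsRing C_NormedModule eventually _ _ s t Hs Ht).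
Qed.

Lemma is_cseries_finite (f : nat -> C) (N : nat) :
  (forall n, (N < n)%nat -> f n = 0%C) ->
  is_cseries f (@sum_n C_NormedModule f N).
Proof.
  intros H. unfold is_series.
  apply filterlim_ext_loc with (f := fun _ => @sum_n C_NormedModule f N);
    [ | apply filterlim_const ].
  exists N. intros n Hn. induction Hn as [|n Hn IH]; [ reflexivity | ].
  rewrite sum_Sn, <- IH, H by lia. symmetry. exact (Cplus_0_r _).
Qed.

Lemma pseries_center_C_derive (a : nat -> C) (u : C -> C) (r : R) (z : C) :
  0 < r ->
  (forall w : C, Cmod (w - z) < r ->
     @is_pseries C_AbsRing C_NormedModule a (w - z)%C (u w)) ->
  C_derive u z = a 1%nat.
Proof.
  intros Hr Hu.
  assert (H : Cmod (z - z)%C < r) by (replace (z - z)%C with (RtoC 0) by ring; now rewrite Cmod_0).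
  destruct (pseries_C_derive a u r z z Hu H) as [_ Hs].
  apply is_pseries_C in Hs.
  apply (is_cseries_unique _ _ _ Hs).
  assert (E := is_cseries_finite (fun n => (INR (S n) * a (S n) * (z - z) ^ n)%C) 0).
  rewrite sum_O in E. cbv beta in E.
  replace (a 1%nat) with (INR 1 * a 1%nat * (z - z) ^ 0)%C by (simpl; ring).
  apply E. intros n Hn. destruct n as [|n]; [ lia | ].
  rewrite Cpow_S. ring.
Qed.

Definition quadratic_coef (a b c z : C) (n : nat) : C :=
  match n with
  | 0%nat => (a + b * z + c * (z * z))%C
  | 1%nat => (b + 2 * c * z)%C
  | 2%nat => c
  | _ => RtoC 0
  end.

Lemma quadratic_pseries (a b c z w : C) :
  @is_pseries C_AbsRing C_NormedModule (quadratic_coef a b c z) (w - z)%C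
    (a + b * w + c * (w * w))%C.
Proof.
  apply is_pseries_C.
  match goal with |- is_cseries ?f ?s => replace s with (@sum_n C_NormedModule f 2) end.
  - apply is_cseries_finite. intros [|[|[|n]]] Hn; try lia. simpl. ring.
  - rewrite !sum_Sn, sum_O. rewrite !Cpow_S.
    change (@plus C_NormedModule) with Cplus. simpl. ring.
Qed.

Lemma quadratic_analytic (a b c : C) :
  analytic_in_disk (fun w => a + b * w + c * (w * w))%C.
Proof.
  intros z _. exists (quadratic_coef a b c z), 1. split; [ exact Rlt_0_1 | ].
  intros w _. apply quadratic_pseries.
Qed.

Lemma quadratic_C_derive (a b c z : C) :
  C_derive (fun w => a + b * w + c * (w * w))%C z = (b + 2 * c * z)%C.
Proof.
  refine (pseries_center_C_derive (quadratic_coef a b c z) _ 1 z Rlt_0_1 _).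
  intros w _. apply quadratic_pseries.
Qed.

Lemma continuous_div_R (f g : C -> R) (z : C) :
  @continuous C_UniformSpace R_UniformSpace f z ->
  @continuous C_UniformSpace R_UniformSpace g z -> g z <> 0 ->
  @continuous C_UniformSpace R_UniformSpace (fun w => f w / g w) z.
Proof.
  intros Hf Hg H0. apply (continuous_mult (K := R_AbsRing) f (fun w => / g w)); [ exact Hf | ].
  apply (continuous_comp g Rinv); [ exact Hg | ].
  apply continuous_Rinv. exact H0.
Qed.

(** * The Schwarz-Pick inequality *)

Lemma Rmax_0_continuous (x : R) : continuous (Rmax 0) x.
Proof.
  apply (continuous_ext (fun y => (y + Rabs y) * / 2)).
  - intros y. unfold Rmax, Rabs. destruct (Rle_dec 0 y), (Rcase_abs y); lra.
  - apply (continuous_mult (K := R_AbsRing) (fun y => y + Rabs y));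
      [ | apply continuous_const ].
    apply (continuous_plus (V := R_NormedModule)); [ apply continuous_id | apply continuous_Rabs ].
Qed.

(** Ahlfors' maximum principle argument on the disk |z|^2 < s.  Cutting off with
    Rmax makes v continuous even where w is not analytic, because there v = 0. *)
Lemma schwarz_pick_lt (w : C -> C) (s : R) (z : C) :
  analytic_in_disk w -> (forall z, in_disk z -> in_disk (w z)) ->
  Cmod z ^ 2 < s -> s < 1 ->
  Cmod (C_derive w z) * (s - Cmod z ^ 2) <= 1 - Cmod (w z) ^ 2.
Proof.
  intros Hw Hmap Hz Hs.
  assert (Hw' := analytic_C_derive w Hw).
  assert (Hdisk : forall q, Cmod q ^ 2 < 1 -> in_disk q).
  { intros q Hq. unfold in_disk. assert (H := Cmod_ge_0 q). nra. }
  assert (Hpos : forall q, in_disk q -> 0 < 1 - Cmod (w q) ^ 2).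
  { intros q Hq. specialize (Hmap q Hq). unfold in_disk in Hmap.
    assert (H := Cmod_ge_0 (w q)). nra. }
  assert (Hs0 : 0 < s) by (assert (H := pow2_ge_0 (Cmod z)); lra).
  set (v := fun q => Cmod (C_derive w q) * Rmax 0 (s - Cmod q ^ 2) / (1 - Cmod (w q) ^ 2)).
  assert (Hsq : forall q, @continuous C_UniformSpace R_UniformSpace (fun q => s - Cmod q ^ 2) q).
  { intros q. apply (continuous_comp Cmod (fun x => s - x ^ 2)); [ apply Cmod_continuous | ].
    apply (ex_derive_continuous (fun x => s - x ^ 2)). auto_derive. exact I. }
  assert (Hcont : forall q, @continuous C_UniformSpace R_UniformSpace v q).
  { intros q. destruct (Rlt_dec (Cmod q) 1) as [Hq|Hq].
    - apply continuous_div_R.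
      + apply (continuous_mult (K := R_AbsRing) (fun q => Cmod (C_derive w q))).
        * apply analytic_Cmod_continuous; assumption.
        * apply (continuous_comp (fun q => s - Cmod q ^ 2) (Rmax 0)); [ apply Hsq | ].
          apply Rmax_0_continuous.
      + apply (continuous_comp (fun q => Cmod (w q)) (fun x => 1 - x ^ 2)).
        * apply analytic_Cmod_continuous; assumption.
        * apply (ex_derive_continuous (fun x => 1 - x ^ 2)). auto_derive. exact I.
      + specialize (Hpos q Hq). lra.
    - apply continuous_ext_loc with (g := fun _ => 0); [ | apply continuous_const ].
      assert (Hneg : s - Cmod q ^ 2 < 0) by nra.
      assert (Hloc : clocally q (fun y => s - Cmod y ^ 2 < 0))
        by exact (Hsq q (fun x => x < 0) (open_lt 0 _ Hneg)).
      refine (filter_imp _ _ _ Hloc). intros y Hy. unfold v. rewrite Rmax_left by lra.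
      unfold Rdiv. rewrite Rmult_0_r, Rmult_0_l. reflexivity. }
  destruct (continuous_attains_max_square v Hcont) as [p Hp].
  assert (Hin : forall q, in_disk q -> v q <= v p).
  { intros q Hq. unfold in_disk in Hq.
    apply Hp; apply Rabs_le_between.
    - assert (H := Cmod_fst_le q); lra.
    - assert (H := Cmod_snd_le q); lra. }
  assert (Hz1 : in_disk z) by (apply Hdisk; lra).
  assert (Hvp : v p <= 1).
  { apply Rnot_lt_le. intros Hvp1.
    assert (Hps : Cmod p ^ 2 < s).
    { apply Rnot_le_lt. intros H. unfold v in Hvp1. rewrite Rmax_left in Hvp1 by lra.
      unfold Rdiv in Hvp1. lra. }
    assert (Hpd : in_disk p) by (apply Hdisk; lra).
    assert (Hp' : 0 < Cmod (C_derive w p)).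
    { destruct (Cmod_ge_0 (C_derive w p)) as [H|H]; [ exact H | ].
      unfold v, Rdiv in Hvp1. rewrite <- H in Hvp1. lra. }
    assert (Hposp := Hpos p Hpd).
    (* log(s - |q|^2) is the case of the identity, written as a quadratic. *)
    assert (Jid := jet2_ln_sub_Cmod_sqr s (fun q => 0 + 1 * q + 0 * (q * q))%C p
                     (quadratic_analytic _ _ _) Hpd).
    rewrite quadratic_C_derive in Jid.
    replace (0 + 1 * p + 0 * (p * p))%C with p in Jid by ring.
    replace (1 + 2 * 0 * p)%C with (RtoC 1) in Jid by ring.
    specialize (Jid Hps).
    assert (J1 := jet2_ln_Cmod_sqr _ p Hw' Hpd (proj2 (Cmod_gt_0 _) Hp')).
    assert (J2 := jet2_ln_sub_Cmod_sqr 1 w p Hw Hpd ltac:(lra)).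
    assert (J := jet2_plus _ _ _ _ _ _ _ J1
                   (jet2_plus _ _ _ _ _ _ _ (jet2_scal (-2) _ _ _ _ J2) (jet2_scal 2 _ _ _ _ Jid))).
    apply jet2_max in J.
    (* J now reads 8 |w'|^2 / (1 - |w|^2)^2 - 8 s / (s - |p|^2)^2 <= 0. *)
    - rewrite Cmod_1 in J.
      assert (Hv2 : v p ^ 2 <= s).
      { unfold v. rewrite Rmax_right by lra.
        replace ((Cmod (C_derive w p) * (s - Cmod p ^ 2) / (1 - Cmod (w p) ^ 2)) ^ 2)
          with (Cmod (C_derive w p) ^ 2 / (1 - Cmod (w p) ^ 2) ^ 2 * (s - Cmod p ^ 2) ^ 2)
          by (field; lra).
        apply Rmult_le_reg_r with (/ (s - Cmod p ^ 2) ^ 2).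
        { apply Rinv_0_lt_compat, pow_lt. lra. }
        rewrite Rmult_assoc, Rinv_r, Rmult_1_r by (apply pow_nonzero; lra).
        unfold Rdiv in *. lra. }
      nra.
    - assert (L1 : clocally p (fun q => 0 < s - Cmod q ^ 2)).
      { apply (Hsq p (fun x => 0 < x)). apply open_gt. lra. }
      assert (L2 : clocally p (fun q => 0 < Cmod (C_derive w q))).
      { apply (analytic_Cmod_continuous _ p Hw' Hpd (fun x => 0 < x)). apply open_gt. exact Hp'. }
      (* Near p the differentiated function is log v^2, so it is maximal at p. *)
      assert (HQ : forall q, 0 < s - Cmod q ^ 2 -> 0 < Cmod (C_derive w q) ->
         ln (Cmod (C_derive w q) ^ 2) + (-2 * ln (1 - Cmod (w q) ^ 2)
           + 2 * ln (s - Cmod (0 + 1 * q + 0 * (q * q)) ^ 2)) = 2 * ln (v q) /\ 0 < v q).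
      { intros q H1 H2. assert (H3 : 0 < 1 - Cmod (w q) ^ 2) by (apply Hpos, Hdisk; lra).
        replace (0 + 1 * q + 0 * (q * q))%C with q by ring.
        unfold v. rewrite Rmax_right by lra.
        rewrite ln_div, ln_mult, ln_pow by (try apply Rmult_lt_0_compat; lra).
        split; [ simpl; ring | ].
        apply Rdiv_lt_0_compat; [ apply Rmult_lt_0_compat; lra | lra ]. }
      generalize (filter_and _ _ L1 L2). apply filter_imp. intros q [H1 H2].
      destruct (HQ q H1 H2) as [-> Hq]. destruct (HQ p ltac:(lra) Hp') as [-> _].
      apply Rmult_le_compat_l; [ lra | ].
      apply ln_le; [ exact Hq | ]. apply Hin, Hdisk. lra. }
  assert (Hvz : v z <= 1) by (specialize (Hin z Hz1); lra).
  unfold v in Hvz. rewrite Rmax_right in Hvz by lra.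
  assert (Hz3 := Hpos z Hz1).
  apply (Rmult_le_compat_r (1 - Cmod (w z) ^ 2)) in Hvz; [ | lra ].
  unfold Rdiv in Hvz. rewrite Rmult_assoc, Rinv_l, Rmult_1_r in Hvz by lra. lra.
Qed.

(** The limit s -> 1 of the previous inequality. *)
Theorem schwarz_pick (w : C -> C) (z : C) :
  analytic_in_disk w -> (forall z, in_disk z -> in_disk (w z)) -> in_disk z ->
  (1 - Cmod z ^ 2) * Cmod (C_derive w z) <= 1 - Cmod (w z) ^ 2.
Proof.
  intros Hw Hmap Hz.
  assert (Hx : Cmod z ^ 2 < 1) by (unfold in_disk in Hz; assert (H := Cmod_ge_0 z); nra).
  set (x := Cmod z ^ 2) in *. set (A := Cmod (C_derive w z)). set (K := 1 - Cmod (w z) ^ 2).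
  assert (HA : 0 <= A) by apply Cmod_ge_0.
  apply le_epsilon. intros e He.
  set (d := Rmin ((1 - x) / 2) (e / (A + 1))).
  assert (Hd : 0 < d) by (apply Rmin_pos; [ lra | apply Rdiv_lt_0_compat; lra ]).
  assert (Hd1 : d <= (1 - x) / 2) by apply Rmin_l.
  assert (Hd2 : d <= e / (A + 1)) by apply Rmin_r.
  assert (H := schwarz_pick_lt w (1 - d) z Hw Hmap). fold x A K in H.
  specialize (H ltac:(lra) ltac:(lra)).
  apply (Rmult_le_compat_r (A + 1)) in Hd2; [ | lra ].
  unfold Rdiv in Hd2. rewrite Rmult_assoc, Rinv_l, Rmult_1_r in Hd2 by lra.
  nra.
Qed.

(** * The pre-Schwarzian derivative of a logharmonic mapping *)

Lemma partial_ext_loc (F G : C -> C) (p : C) :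
  clocally p (fun z => F z = G z) ->
  partial_x F p = partial_x G p /\ partial_y F p = partial_y G p.
Proof.
  intros H. unfold partial_x, partial_y.
  split; f_equal; apply Derive_ext_loc.
  1, 2: refine (filter_imp _ _ _ (locally_horizontal _ _ H)).
  3, 4: refine (filter_imp _ _ _ (locally_vertical _ _ H)).
  all: intros t Ht; now rewrite Ht.
Qed.

Lemma dz_ext_loc (F G : C -> C) (p : C) :
  clocally p (fun z => F z = G z) -> dz F p = dz G p.
Proof.
  intros H. destruct (partial_ext_loc F G p H) as [Hx Hy]. unfold dz. now rewrite Hx, Hy.
Qed.

Lemma dzbar_ext_loc (F G : C -> C) (p : C) :
  clocally p (fun z => F z = G z) -> dzbar F p = dzbar G p.
Proof.
  intros H. destruct (partial_ext_loc F G p H) as [Hx Hy]. unfold dzbar. now rewrite Hx, Hy.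
Qed.

Lemma is_derive_R_mult (p q : R -> R) (t a b : R) :
  is_derive p t a -> is_derive q t b ->
  is_derive (fun s => p s * q s) t (a * q t + p t * b).
Proof. intros Hp Hq. exact (is_derive_mult p q t a b Hp Hq Rmult_comm). Qed.

Lemma partials_mul_conj (h g : C -> C) (p h' g' : C) :
  has_cderive h p h' -> has_cderive g p g' ->
  partial_x (fun z => h z * Cconj (g z))%C p
    = (h' * Cconj (g p) + h p * Cconj g')%C /\
  partial_y (fun z => h z * Cconj (g z))%C p
    = (Ci * (h' * Cconj (g p) - h p * Cconj g'))%C.
Proof.
  intros Hh Hg.
  apply has_cderive_partials in Hh. apply has_cderive_partials in Hg.
  destruct Hh as [[hx1 hx2] [hy1 hy2]], Hg as [[gx1 gx2] [gy1 gy2]].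
  assert (Hfst : forall z w, fst z * fst w + snd z * snd w = fst (z * Cconj w)%C)
    by (intros z w; simpl; ring).
  assert (Hsnd : forall z w, snd z * fst w + (- 1) * (fst z * snd w) = snd (z * Cconj w)%C)
    by (intros z w; simpl; ring).
  destruct p as [x y]. unfold partial_x, partial_y. simpl fst in *; simpl snd in *.
  split; apply injective_projections;
    (etransitivity;
     [ apply is_derive_unique; simpl;
       first
       [ eapply is_derive_ext; [ intros t; apply Hfst | ];
         eapply (is_derive_plus (V := R_NormedModule)); eapply is_derive_R_mult; eassumption
       | eapply is_derive_ext; [ intros t; apply Hsnd | ];
         eapply (is_derive_plus (V := R_NormedModule));
         [ eapply is_derive_R_mult; eassumption
         | eapply is_derive_scal;
           eapply is_derive_R_mult; eassumption ] ]
     | ]).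
  all: cbv [plus scal]; simpl; ring.
Qed.

Lemma dz_mul_conj (h g : C -> C) (p h' g' : C) :
  has_cderive h p h' -> has_cderive g p g' ->
  dz (fun z => h z * Cconj (g z))%C p = (h' * Cconj (g p))%C /\
  dzbar (fun z => h z * Cconj (g z))%C p = (h p * Cconj g')%C.
Proof.
  intros Hh Hg. destruct (partials_mul_conj h g p h' g' Hh Hg) as [Hx Hy].
  assert (Hi : (Ci * Ci)%C = (- (1))%C)
    by (unfold Ci, Cmult, Copp, RtoC; simpl; f_equal; ring).
  unfold dz, dzbar. rewrite Hx, Hy, !Cmult_assoc, Hi.
  assert (H2 : RtoC 2 <> 0%C) by (intros K; apply RtoC_inj in K; lra).
  split; field; exact H2.
Qed.

(** f_z = h' conj(g) and f_zbar = h conj(g'), with |h g'| = |w| |h' g|. *)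
Lemma jacobian_logharmonic (f h g : C -> C) (p : C) :
  sense_preserving_logharmonic f h g -> in_disk p ->
  jacobian f p =
    Cmod (C_derive h p * g p) ^ 2 * (1 - Cmod (dilatation h g p) ^ 2).
Proof.
  intros (Hf & Hh & Hg & Hh' & Hg0 & _ & _) Hp.
  assert (Hloc : clocally p (fun z => f z = (h z * Cconj (g z))%C)).
  { refine (filter_imp _ _ Hf (locally_in_disk p Hp)). }
  destruct (dz_mul_conj h g p _ _ (analytic_has_cderive h p Hh Hp)
              (analytic_has_cderive g p Hg Hp)) as [E1 E2].
  unfold jacobian. rewrite (dz_ext_loc f (fun z => h z * Cconj (g z))%C p Hloc),
    (dzbar_ext_loc f (fun z => h z * Cconj (g z))%C p Hloc), E1, E2.
  unfold dilatation.
  assert (A1 := proj1 (Cmod_gt_0 _) (Hh' p Hp)). assert (A2 := proj1 (Cmod_gt_0 _) (Hg0 p Hp)).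
  rewrite Cmod_div by (apply Cmult_neq_0; auto).
  rewrite !Cmod_mult, !Cmod_conj. field. lra.
Qed.

(** log J_f = log|psi'|^2 + log(1 - |w|^2), and both Wirtinger derivatives are
    known. *)
Lemma preSchwarzian_logharmonic (f h g psi : C -> C) (p : C) :
  sense_preserving_logharmonic f h g -> analytic_in_disk psi ->
  (forall z : C, in_disk z -> C_derive psi z = (C_derive h z * g z)%C) ->
  in_disk p ->
  preSchwarzian f p =
    (preSchwarzian_analytic psi p
     - Cconj (dilatation h g p) * C_derive (dilatation h g) p
       / RtoC (1 - Cmod (dilatation h g p) ^ 2))%C.
Proof.
  intros Hlog Hpsi Hpsi' Hp.
  assert (Hlog' := Hlog).
  destruct Hlog' as (_ & _ & _ & Hh' & Hg0 & Hw & Hmap).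
  set (w := dilatation h g) in *.
  assert (Hnz : forall z, in_disk z -> C_derive psi z <> 0%C)
    by (intros z Hz; rewrite Hpsi' by exact Hz; apply Cmult_neq_0; auto).
  assert (Hpos : forall z, in_disk z -> Cmod (w z) ^ 2 < 1).
  { intros z Hz. specialize (Hmap z Hz). unfold in_disk in Hmap.
    assert (H := Cmod_ge_0 (w z)). nra. }
  assert (J := jet2_plus _ _ _ _ _ _ _
     (jet2_ln_Cmod_sqr _ p (analytic_C_derive psi Hpsi) Hp (Hnz p Hp))
     (jet2_ln_sub_Cmod_sqr 1 w p Hw Hp (Hpos p Hp))).
  apply jet2_dz in J.
  unfold preSchwarzian. etransitivity; [ | exact J ].
  apply dz_ext_loc.
  refine (filter_imp _ _ _ (locally_in_disk p Hp)). intros z Hz.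
  rewrite (jacobian_logharmonic f h g z Hlog Hz). fold w. rewrite <- Hpsi' by exact Hz.
  rewrite ln_mult; [ reflexivity | | ].
  - apply pow_lt, Cmod_gt_0, Hnz, Hz.
  - specialize (Hpos z Hz). lra.
Qed.

(** The Schwarz-Pick factor cancels 1 - |w|^2 and leaves |w| <= 1. *)
Lemma weighted_preSchwarzian_diff_le_1 (f h g psi : C -> C) (p : C) :
  sense_preserving_logharmonic f h g -> analytic_in_disk psi ->
  (forall z : C, in_disk z -> C_derive psi z = (C_derive h z * g z)%C) ->
  in_disk p ->
  (1 - Cmod p ^ 2) * Cmod (preSchwarzian f p - preSchwarzian_analytic psi p)%C <= 1.
Proof.
  intros Hlog Hpsi Hpsi' Hp.
  rewrite (preSchwarzian_logharmonic f h g psi p Hlog Hpsi Hpsi' Hp).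
  destruct Hlog as (_ & _ & _ & _ & _ & Hw & Hmap).
  set (w := dilatation h g) in *.
  assert (SP := schwarz_pick w p Hw Hmap Hp).
  assert (Hwp := Hmap p Hp). unfold in_disk in Hwp.
  assert (H0 := Cmod_ge_0 (w p)).
  assert (HK : 0 < 1 - Cmod (w p) ^ 2) by nra.
  match goal with |- _ * Cmod ?X <= _ => replace X with
    (- (Cconj (w p) * C_derive w p / RtoC (1 - Cmod (w p) ^ 2)))%C by ring end.
  rewrite Cmod_opp, Cmod_div, Cmod_mult, Cmod_conj, Cmod_R, Rabs_right
    by first [ lra | intros K; apply RtoC_inj in K; lra ].
  set (K := 1 - Cmod (w p) ^ 2) in *.
  apply Rmult_le_reg_r with K; [ exact HK | ].
  replace ((1 - Cmod p ^ 2) * (Cmod (w p) * Cmod (C_derive w p) / K) * K)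
    with (Cmod (w p) * ((1 - Cmod p ^ 2) * Cmod (C_derive w p))) by (field; lra).
  apply Rle_trans with (Cmod (w p) * K).
  - apply Rmult_le_compat_l; assumption.
  - nra.
Qed.

(** * Comparison of norms *)

Lemma in_disk_weight_pos (z : C) : in_disk z -> 0 < 1 - Cmod z ^ 2.
Proof. unfold in_disk. intros Hz. assert (H := Cmod_ge_0 z). nra. Qed.

Lemma preSchwarzian_norm_ge (P : C -> C) (z : C) :
  in_disk z -> Rbar_le ((1 - Cmod z ^ 2) * Cmod (P z)) (preSchwarzian_norm P).
Proof.
  intros Hz. apply (proj1 (Lub_Rbar_correct _)). now exists z.
Qed.

Lemma preSchwarzian_norm_le (P : C -> C) (b : Rbar) :
  (forall z, in_disk z -> Rbar_le ((1 - Cmod z ^ 2) * Cmod (P z)) b) ->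
  Rbar_le (preSchwarzian_norm P) b.
Proof.
  intros H. apply (proj2 (Lub_Rbar_correct _)). intros x (z & Hz & ->). now apply H.
Qed.

Lemma preSchwarzian_norm_not_m_infty (P : C -> C) : preSchwarzian_norm P <> m_infty.
Proof.
  intros E.
  assert (H0 : in_disk 0%C) by (unfold in_disk; rewrite Cmod_0; lra).
  assert (H := preSchwarzian_norm_ge P 0%C H0). rewrite E in H. exact H.
Qed.

Lemma preSchwarzian_norm_perturb (P Q : C -> C) (c : R) :
  (forall z, in_disk z -> (1 - Cmod z ^ 2) * Cmod (P z - Q z)%C <= c) ->
  Rbar_le (preSchwarzian_norm P) (Rbar_plus (preSchwarzian_norm Q) c).
Proof.
  intros H. apply preSchwarzian_norm_le. intros z Hz.
  assert (HQ := preSchwarzian_norm_ge Q z Hz).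
  specialize (H z Hz). assert (Hw := in_disk_weight_pos z Hz).
  assert (T : Cmod (P z) <= Cmod (P z - Q z)%C + Cmod (Q z)).
  { replace (P z) with (P z - Q z + Q z)%C at 1 by ring. apply Cmod_triangle. }
  destruct (preSchwarzian_norm Q) as [q| |]; simpl in HQ |- *; [ nra | exact I | exact HQ ].
Qed.

(** * The extremal mapping *)

(** Absolute convergence gives a sum s, and shifting the series by one term shows
    s - 1 = q s. *)
Lemma is_cseries_geom (q : C) : Cmod q < 1 -> is_cseries (fun n => q ^ n)%C (/ (1 - q))%C.
Proof.
  intros Hq.
  assert (Hne : (1 - q)%C <> 0%C).
  { intros K. assert (q = 1%C) by (replace q with (1 - (1 - q))%C by ring; rewrite K; ring).
    subst q. rewrite Cmod_1 in Hq. lra. }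
  destruct (ex_series_C_le (fun n => q ^ n)%C (fun n => Cmod q ^ n)) as [s Hs].
  - intros n. rewrite Cmod_pow. apply Rle_refl.
  - exists (/ (1 - Cmod q)). apply is_series_geom. rewrite Rabs_right; [ exact Hq | ].
    apply Rle_ge, Cmod_ge_0.
  - assert (H1 := is_cseries_shift _ _ Hs).
    assert (H2 := @is_series_scal C_AbsRing C_NormedModule q _ _ Hs).
    assert (E : (s - 1)%C = (q * s)%C).
    { apply (is_cseries_unique (fun n => q ^ S n)%C); [ exact H1 | ].
      exact (is_cseries_ext _ _ _ (fun n => eq_sym (Cpow_S q n)) H2). }
    replace (/ (1 - q))%C with s; [ exact Hs | ].
    assert (E' : (s * (1 - q))%C = 1%C).
    { replace (s * (1 - q))%C with (s - q * s)%C by ring. rewrite <- E. ring. }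
    replace s with (s * (1 - q) / (1 - q))%C by (field; exact Hne).
    rewrite E'. field. exact Hne.
Qed.

Definition extremal_h (z : C) : C := (2 * z / (2 + z))%C.
(** The terms of (1 + z/2)^2, in the shape of [quadratic_C_derive]. *)
Definition extremal_g (z : C) : C := (1 + 1 * z + / 4 * (z * z))%C.

(** From h(w) = 2 - 4/(2 + w), expanding the fraction around z as a geometric
    series of ratio -(w - z)/(2 + z). *)
Definition extremal_h_coef (z : C) (n : nat) : C :=
  ((match n with 0%nat => 2 | _ => 0 end)%R
   + - (4 / (2 + z)) * (- / (2 + z)) ^ n)%C.

(** So the expansion around z converges at least on the unit disk centred at z. *)
Lemma Cmod_two_plus (z : C) : in_disk z -> 1 < Cmod (2 + z)%C.
Proof.
  unfold in_disk. intros Hz.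
  assert (T : Cmod 2 <= Cmod (2 + z)%C + Cmod (- z)%C).
  { replace (RtoC 2) with (2 + z + - z)%C at 1 by ring. apply Cmod_triangle. }
  rewrite Cmod_opp, Cmod_R, Rabs_right in T; lra.
Qed.

Lemma two_plus_neq_0 (z : C) : in_disk z -> (2 + z)%C <> 0%C.
Proof. intros Hz. apply Cmod_gt_0. assert (H := Cmod_two_plus z Hz). lra. Qed.

Lemma extremal_h_pseries (z w : C) :
  in_disk z -> Cmod (w - z)%C < 1 ->
  @is_pseries C_AbsRing C_NormedModule (extremal_h_coef z) (w - z)%C (extremal_h w).
Proof.
  intros Hz Hw. apply is_pseries_C.
  assert (Hz2 := Cmod_two_plus z Hz).
  assert (Hz0 := two_plus_neq_0 z Hz).
  assert (Hw0 : (2 + w)%C <> 0%C).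
  { apply Cmod_gt_0.
    assert (T : Cmod (2 + z)%C <= Cmod (2 + w)%C + Cmod (- (w - z))%C).
    { replace (2 + z)%C with (2 + w + - (w - z))%C by ring. apply Cmod_triangle. }
    rewrite Cmod_opp in T. lra. }
  set (q := (- / (2 + z) * (w - z))%C).
  assert (Hq : Cmod q < 1).
  { unfold q. rewrite Cmod_mult, Cmod_opp, Cmod_inv by exact Hz0.
    assert (/ Cmod (2 + z)%C < 1) by (rewrite <- Rinv_1; apply Rinv_lt_contravar; lra).
    assert (0 < / Cmod (2 + z)%C) by (apply Rinv_0_lt_compat; lra).
    assert (Hk := Cmod_ge_0 (w - z)). nra. }
  assert (Hgeom := @is_series_scal C_AbsRing C_NormedModule (- (4 / (2 + z)))%C _ _
                     (is_cseries_geom q Hq)).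
  assert (Htwo := is_cseries_finite
    (fun n => RtoC (match n with 0%nat => 2 | _ => 0 end)%R) 0).
  rewrite sum_O in Htwo.
  assert (H := @is_series_plus C_AbsRing C_NormedModule _ _ _ _
                 (Htwo ltac:(intros [|n] Hn; [ lia | reflexivity ])) Hgeom).
  match type of H with is_cseries _ ?s => replace (extremal_h w) with s end.
  - refine (is_cseries_ext _ _ _ _ H). intros n.
    change ((RtoC (match n with 0%nat => 2 | _ => 0 end)%R + - (4 / (2 + z)) * q ^ n
             = extremal_h_coef z n * (w - z) ^ n)%C).
    unfold extremal_h_coef, q. rewrite Cpow_mult_l. destruct n; [ simpl; ring | ].
    ring.
  - change ((2 + - (4 / (2 + z)) * / (1 - q) = extremal_h w)%C).
    unfold extremal_h, q. field.
    now split.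
Qed.

Lemma extremal_h_analytic : analytic_in_disk extremal_h.
Proof.
  intros z Hz. exists (extremal_h_coef z), 1. split; [ exact Rlt_0_1 | ].
  intros w Hw. now apply extremal_h_pseries.
Qed.

Lemma extremal_h_C_derive (z : C) :
  in_disk z -> C_derive extremal_h z = (4 / ((2 + z) * (2 + z)))%C.
Proof.
  intros Hz.
  rewrite (pseries_center_C_derive (extremal_h_coef z) extremal_h 1 z Rlt_0_1)
    by (intros w Hw; now apply extremal_h_pseries).
  assert (Hz0 := two_plus_neq_0 z Hz).
  unfold extremal_h_coef. simpl. field. exact Hz0.
Qed.

Lemma extremal_g_factor (z : C) : extremal_g z = ((2 + z) * (2 + z) / 4)%C.
Proof. unfold extremal_g. field. Qed.

Lemma C4_neq_0 : RtoC 4 <> 0%C.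
Proof. intros K; apply RtoC_inj in K; lra. Qed.

Lemma extremal_g_neq_0 (z : C) : in_disk z -> extremal_g z <> 0%C.
Proof.
  intros Hz. assert (Hz0 := two_plus_neq_0 z Hz).
  rewrite extremal_g_factor. apply Cmod_gt_0. rewrite Cmod_div by exact C4_neq_0.
  apply Rdiv_lt_0_compat; apply Cmod_gt_0; [ now apply Cmult_neq_0 | exact C4_neq_0 ].
Qed.

Lemma extremal_dilatation (z : C) : in_disk z -> dilatation extremal_h extremal_g z = z.
Proof.
  intros Hz. assert (Hz0 := two_plus_neq_0 z Hz).
  unfold dilatation. rewrite (extremal_h_C_derive z Hz), extremal_g_factor.
  unfold extremal_g at 1. rewrite quadratic_C_derive. unfold extremal_h. field.
  exact Hz0.
Qed.

(** Lets the lemmas on quadratic polynomials apply to the identity. *)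
Lemma identity_quadratic : (fun z : C => z) = (fun z => 0 + 1 * z + 0 * (z * z))%C.
Proof. apply functional_extensionality. intros z. ring. Qed.

Lemma identity_analytic : analytic_in_disk (fun z => z).
Proof. rewrite identity_quadratic. apply quadratic_analytic. Qed.

Lemma identity_C_derive : C_derive (fun z => z) = (fun _ => RtoC 1).
Proof.
  apply functional_extensionality. intros z.
  rewrite identity_quadratic, quadratic_C_derive. ring.
Qed.

Lemma const_C_derive (k z : C) : C_derive (fun _ => k) z = 0%C.
Proof. apply is_C_derive_unique. exact (@is_derive_const C_AbsRing C_NormedModule k z). Qed.

Lemma analytic_ext (u v : C -> C) :
  (forall z, in_disk z -> u z = v z) -> analytic_in_disk u -> analytic_in_disk v.
Proof.
  intros E Hu z Hz. destruct (Hu z Hz) as (a & r & Hr & H).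
  assert (Hr' : 0 < Rmin r (1 - Cmod z)) by (apply Rmin_pos; [ exact Hr | unfold in_disk in Hz; lra ]).
  exists a, (Rmin r (1 - Cmod z)). split; [ exact Hr' | ].
  intros w Hw. assert (H1 := Rmin_l r (1 - Cmod z)). assert (H2 := Rmin_r r (1 - Cmod z)).
  rewrite <- E; [ apply H; lra | ].
  unfold in_disk. replace w with (w - z + z)%C by ring.
  eapply Rle_lt_trans; [ apply Cmod_triangle | lra ].
Qed.

Definition extremal_f (z : C) : C := (extremal_h z * Cconj (extremal_g z))%C.

Lemma extremal_logharmonic : sense_preserving_logharmonic extremal_f extremal_h extremal_g.
Proof.
  split; [ reflexivity | ].
  split; [ exact extremal_h_analytic | ].
  split; [ apply quadratic_analytic | ].
  split.
  { intros z Hz. assert (Hz0 := two_plus_neq_0 z Hz).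
    rewrite extremal_h_C_derive by exact Hz.
    apply Cmod_gt_0. rewrite Cmod_div by now apply Cmult_neq_0.
    apply Rdiv_lt_0_compat; apply Cmod_gt_0; [ exact C4_neq_0 | now apply Cmult_neq_0 ]. }
  split; [ exact extremal_g_neq_0 | ].
  split.
  - apply (analytic_ext (fun z => z)); [ | exact identity_analytic ].
    intros z Hz. symmetry. now apply extremal_dilatation.
  - intros z Hz. now rewrite extremal_dilatation.
Qed.

Lemma extremal_psi (z : C) :
  in_disk z -> C_derive (fun z => z) z = (C_derive extremal_h z * extremal_g z)%C.
Proof.
  intros Hz. assert (Hz0 := two_plus_neq_0 z Hz).
  rewrite identity_C_derive, (extremal_h_C_derive z Hz), extremal_g_factor. field. exact Hz0.
Qed.

Lemma preSchwarzian_identity (z : C) : preSchwarzian_analytic (fun z => z) z = 0%C.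
Proof.
  unfold preSchwarzian_analytic. rewrite identity_C_derive, const_C_derive.
  unfold Cdiv. ring.
Qed.

Lemma extremal_norm_psi : preSchwarzian_norm (preSchwarzian_analytic (fun z => z)) = 0.
Proof.
  apply Rbar_le_antisym.
  - apply preSchwarzian_norm_le. intros z Hz. rewrite preSchwarzian_identity, Cmod_0.
    simpl. lra.
  - assert (H0 : in_disk 0%C) by (unfold in_disk; rewrite Cmod_0; lra).
    eapply Rbar_le_trans; [ | apply (preSchwarzian_norm_ge _ 0%C H0) ].
    rewrite preSchwarzian_identity, Cmod_0. simpl. lra.
Qed.

Lemma C_derive_ext_loc (u v : C -> C) (z : C) :
  analytic_in_disk u -> in_disk z -> (forall w, in_disk w -> u w = v w) ->
  C_derive v z = C_derive u z.
Proof.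
  intros Hu Hz E. apply is_C_derive_unique.
  apply (@is_derive_ext_loc C_AbsRing C_NormedModule u); [ | now apply analytic_has_cderive ].
  apply locally_C. refine (filter_imp _ _ E (locally_in_disk z Hz)).
Qed.

(** P_psi = 0 and w(z) = z, so P_f = - conj(z) / (1 - |z|^2). *)
Lemma extremal_weighted_preSchwarzian (z : C) :
  in_disk z -> (1 - Cmod z ^ 2) * Cmod (preSchwarzian extremal_f z) = Cmod z.
Proof.
  intros Hz. assert (Hw := in_disk_weight_pos z Hz).
  rewrite (preSchwarzian_logharmonic _ _ _ _ z extremal_logharmonic identity_analytic extremal_psi Hz).
  rewrite (C_derive_ext_loc (fun z => z) _ z identity_analytic Hz)
    by (intros w Hw'; symmetry; now apply extremal_dilatation).
  rewrite preSchwarzian_identity, identity_C_derive, (extremal_dilatation z Hz).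
  match goal with |- _ * Cmod ?X = _ => replace X with
    (- (Cconj z / RtoC (1 - Cmod z ^ 2)))%C by (unfold Cdiv; ring) end.
  rewrite Cmod_opp, Cmod_div, Cmod_conj, Cmod_R, Rabs_right
    by first [ lra | intros K; apply RtoC_inj in K; lra ].
  field. lra.
Qed.

Lemma extremal_norm_f : preSchwarzian_norm (preSchwarzian extremal_f) = 1.
Proof.
  apply Rbar_le_antisym.
  - apply preSchwarzian_norm_le. intros z Hz.
    rewrite extremal_weighted_preSchwarzian by exact Hz. unfold in_disk in Hz. simpl. lra.
  - assert (Hge : forall x, 0 <= x < 1 -> Rbar_le x (preSchwarzian_norm (preSchwarzian extremal_f))).
    { intros x Hx. assert (Hm : Cmod (RtoC x) = x) by (rewrite Cmod_R; apply Rabs_right; lra).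
      assert (Hd : in_disk (RtoC x)) by (unfold in_disk; lra).
      assert (H := preSchwarzian_norm_ge (preSchwarzian extremal_f) _ Hd).
      now rewrite (extremal_weighted_preSchwarzian _ Hd), Hm in H. }
    destruct (preSchwarzian_norm (preSchwarzian extremal_f)) as [b| |]; simpl in *.
    + apply Rnot_lt_le. intros Hb. assert (H0 := Hge 0 ltac:(lra)).
      specialize (Hge ((1 + b) / 2) ltac:(lra)). lra.
    + exact I.
    + exact (Hge 0 ltac:(lra)).
Qed.

Theorem theorem3p1 :
  (forall f h g psi : C -> C,
     sense_preserving_logharmonic f h g ->
     analytic_in_disk psi ->
     (forall z : C, in_disk z -> C_derive psi z = (C_derive h z * g z)%C) ->
     ((preSchwarzian_norm (preSchwarzian f) = p_infty /\
       preSchwarzian_norm (preSchwarzian_analytic psi) = p_infty) \/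
      (is_finite (preSchwarzian_norm (preSchwarzian f)) /\
       is_finite (preSchwarzian_norm (preSchwarzian_analytic psi)))) /\
     (is_finite (preSchwarzian_norm (preSchwarzian f)) ->
      Rabs (real (preSchwarzian_norm (preSchwarzian f)) -
            real (preSchwarzian_norm (preSchwarzian_analytic psi))) <= 1)) /\
  (forall c : R,
     (forall f h g psi : C -> C,
        sense_preserving_logharmonic f h g ->
        analytic_in_disk psi ->
        (forall z : C, in_disk z -> C_derive psi z = (C_derive h z * g z)%C) ->
        is_finite (preSchwarzian_norm (preSchwarzian f)) ->
        Rabs (real (preSchwarzian_norm (preSchwarzian f)) -
              real (preSchwarzian_norm (preSchwarzian_analytic psi))) <= c) ->
     1 <= c).
Proof.
  split.
  - intros f h g psi Hlog Hpsi Hpsi'.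
    assert (H1 := preSchwarzian_norm_perturb (preSchwarzian f) (preSchwarzian_analytic psi) 1
      (fun z Hz => weighted_preSchwarzian_diff_le_1 f h g psi z Hlog Hpsi Hpsi' Hz)).
    assert (H2 := preSchwarzian_norm_perturb (preSchwarzian_analytic psi) (preSchwarzian f) 1).
    assert (M1 := preSchwarzian_norm_not_m_infty (preSchwarzian f)).
    assert (M2 := preSchwarzian_norm_not_m_infty (preSchwarzian_analytic psi)).
    assert (H2' : Rbar_le (preSchwarzian_norm (preSchwarzian_analytic psi))
                    (Rbar_plus (preSchwarzian_norm (preSchwarzian f)) 1)).
    { apply H2. intros z Hz.
      rewrite <- (Cmod_opp (preSchwarzian_analytic psi z - preSchwarzian f z)), Copp_minus_distr.
      exact (weighted_preSchwarzian_diff_le_1 f h g psi z Hlog Hpsi Hpsi' Hz). }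
    destruct (preSchwarzian_norm (preSchwarzian f)) as [x| |];
    destruct (preSchwarzian_norm (preSchwarzian_analytic psi)) as [y| |];
      simpl in H1, H2'; try contradiction; try congruence.
    + split; [ right; split; reflexivity | ]. intros _. simpl. apply Rabs_le. lra.
    + split; [ left; split; reflexivity | ]. intros K. discriminate K.
  - intros c Hc.
    specialize (Hc extremal_f extremal_h extremal_g (fun z => z)
                  extremal_logharmonic identity_analytic extremal_psi).
    rewrite extremal_norm_f, extremal_norm_psi in Hc.
    specialize (Hc eq_refl). simpl in Hc. rewrite Rabs_right in Hc; lra.
Qed.
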